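(* Let $\pi\in S_n$ and $1 \le i \le n-1$. The quotient $q^\pi_i : \mathcal{U}^\pi_\Lambda \to \mathbb{R}$ defined by $q^\pi_i(T) = \beta^\pi_i(T)/(T)_{i+1,i}$ (understood, at matrices $T$ with $(T)_{i+1,i}=0$, as the continuous extension of the quotient from the open dense set where $(T)_{i+1,i}\neq 0$) is well defined, smooth and positive on $\mathcal{U}^\pi_\Lambda$, and $q^\pi_i(\Lambda^\pi) = 1$. Also, $q^\pi_i(ETE) = q^\pi_i(T)$ for all $T \in \mathcal{U}^\pi_\Lambda$ and all $E \in \mathcal{E}$.
   Context: Fix real numbers $\lambda_1 < \cdots < \lambda_n$ ($n \ge 2$) and $\Lambda = \operatorname{diag}(\lambda_1,\ldots,\lambda_n)$. Let $\mathcal{T}_\Lambda$ be the set of real symmetric tridiagonal $n\times n$ matrices conjugate to $\Lambda$, which is a compact smooth submanifold, of dimension $n-1$, of the vector space of real symmetric tridiagonal matrices. $\mathcal{E}$ is the group of sign diagonals, i.e. matrices $\operatorname{diag}(\pm1,\ldots,\pm1)$ of order $n$. $Q^*$ denotes the transpose and $O(n)$ the real orthogonal group. A square matrix $M$ is $LU$-positive if it admits a (unique) factorization $M = LU$ with $L = \mathbf{L}(M)$ lower triangular with unit diagonal and $U$ upper triangular with positive diagonal entries. For $\pi \in S_n$, let $\lambda^\pi_i = \lambda_{\pi(i)}$ and $\Lambda^\pi = \operatorname{diag}(\lambda^\pi_1,\ldots,\lambda^\pi_n)$. The chart domain $\mathcal{U}^\pi_\Lambda$ is the set of $T\in\mathcal{T}_\Lambda$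 for which there exists a (necessarily unique) $LU$-positive matrix $Q_\pi \in O(n)$ with $T = Q_\pi^*\Lambda^\pi Q_\pi$; it is an open dense subset of $\mathcal{T}_\Lambda$, invariant under $T\mapsto ETE$ for $E\in\mathcal{E}$. For $T\in\mathcal{U}^\pi_\Lambda$ let $L_\pi = \mathbf{L}(Q_\pi)$ and $B_\pi = L_\pi^{-1}\Lambda^\pi L_\pi$; this matrix is lower bidiagonal, and the $\pi$-bidiagonal coordinates of $T$ are $\beta^\pi_i(T) = (B_\pi)_{i+1,i}$, $i=1,\ldots,n-1$. The map $T\mapsto(\beta^\pi_1(T),\ldots,\beta^\pi_{n-1}(T))$ is a diffeomorphism from $\mathcal{U}^\pi_\Lambda$ onto $\mathbb{R}^{n-1}$. *)

(* Defs.v *)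
From HB Require Import structures.
From mathcomp Require Import all_boot all_order all_algebra perm.
From mathcomp Require Import all_classical all_reals all_analysis.
Set Implicit Arguments.
Unset Strict Implicit.
Unset Printing Implicit Defensive.
Import Order.TTheory GRing.Theory Num.Theory.
Import numFieldNormedType.Exports.
Local Open Scope classical_set_scope.
Local Open Scope ring_scope.

Section Smoothness.
Variables (R : realType) (V : normedModType R).

(* For W open and V finite-dimensional this is the usual class C^k(W). *)
Fixpoint Ck_on (k : nat) (W : set V) (F : V -> R) : Prop :=
  match k with
  | 0 => forall x, W x -> {for x, continuous F}
  | k'.+1 => (forall x, W x -> differentiable F x) /\
             (forall v, Ck_on k' W (fun x => 'D_v F x))
  end.

Definition smooth_on_open (W : set V) (F : V -> R) : Prop :=
  forall k, Ck_on k W F.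

(* Local extendability to smooth functions on open sets of the ambient space:
   for X open in an embedded submanifold of V, this is smoothness for the
   induced manifold structure. *)
Definition smooth_on (X : set V) (f : V -> R) : Prop :=
  forall x, X x -> exists W F,
    [/\ open W, W x, smooth_on_open W F & forall y, X y -> W y -> F y = f y].

End Smoothness.

Section BidiagonalCoordinates.
Variables (R : realType) (n : nat).
Implicit Types (M L U Q T S E : 'M[R]_n.+2) (lambda : 'I_n.+2 -> R).
Implicit Types (s : 'S_n.+2) (i : 'I_n.+1).

(* Matrices have order n + 2 and indices start at 0: the ordinal i stands for
   the index i + 1 in {1, ..., order - 1}. *)
Definition subdiag M i : R := M (lift ord0 i) (widen_ord (leqnSn n.+1) i).

Definition tridiagonal M : Prop :=
  forall j k : 'I_n.+2, (j.+1 < k)%N || (k.+1 < j)%N -> M j k = 0.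

Definition Diag lambda : 'M[R]_n.+2 := diag_mx (\row_j lambda j).

Definition permuted lambda s : 'I_n.+2 -> R := fun j => lambda (s j).

Definition isospectral lambda : set 'M[R]_n.+2 :=
  [set T | [/\ T^T = T, tridiagonal T & similar_in unitmx T (Diag lambda)]].

Definition sign_diagonal E : Prop :=
  exists e : 'I_n.+2 -> R, (forall j, e j = 1 \/ e j = -1) /\ E = Diag e.

Definition orthogonal_mx Q : Prop := Q^T *m Q = 1%:M.

(* is_trig_mx means lower triangular. *)
Definition LU_factors M L U : Prop :=
  [/\ is_trig_mx L, (forall j, L j j = 1),
      is_trig_mx U^T, (forall j, 0 < U j j) & M = L *m U].

Definition LU_positive M : Prop := exists L U, LU_factors M L U.

(* Factorizations are unique, so the choice made by get is harmless on
   LU-positive matrices; the same holds for chart_Q on chart_domain. *)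
Definition Lpart M : 'M[R]_n.+2 := get [set L | exists U, LU_factors M L U].

Definition diagonalizes lambda s T Q : Prop :=
  [/\ orthogonal_mx Q, LU_positive Q
    & T = Q^T *m Diag (permuted lambda s) *m Q].

Definition chart_domain lambda s : set 'M[R]_n.+2 :=
  [set T | isospectral lambda T /\ exists Q, diagonalizes lambda s T Q].

Definition chart_Q lambda s T : 'M[R]_n.+2 :=
  get [set Q | diagonalizes lambda s T Q].

Definition chart_B lambda s T : 'M[R]_n.+2 :=
  let L := Lpart (chart_Q lambda s T) in
  invmx L *m Diag (permuted lambda s) *m L.

Definition beta lambda s i T : R := subdiag (chart_B lambda s T) i.

Definition unreduced_at lambda s i : set 'M[R]_n.+2 :=
  [set T | chart_domain lambda s T /\ subdiag T i != 0].

Definition raw_quotient lambda s i T : R := beta lambda s i T / subdiag T i.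

Definition ext_quotient lambda s i T : R :=
  if subdiag T i != 0 then raw_quotient lambda s i T
  else lim (raw_quotient lambda s i S
            @[S --> within (unreduced_at lambda s i) (nbhs T)]).

End BidiagonalCoordinates.

(* Main.v *)
Require Import Defs.
From HB Require Import structures.
From mathcomp Require Import all_boot all_order all_algebra perm.
From mathcomp Require Import all_classical all_reals all_analysis.
From mathcomp Require Import zify ring.
Import Order.TTheory GRing.Theory Num.Theory.
Import numFieldNormedType.Exports.
Local Open Scope classical_set_scope.
Local Open Scope ring_scope.
Set Implicit Arguments.
Unset Strict Implicit.
Unset Printing Implicit Defensive.

(** Write [T = Q^T *m D *m Q] with [D] the permuted diagonal matrix and
    [Q = L *m U], and let [B = L^-1 D L] be the bidiagonal matrix of [T].
    Then [B U = U T].  Both sides are upper Hessenberg, so their subdiagonal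
    entries are single products, and comparing them gives
    [beta_i = T_(i+1,i) * U_(i+1,i+1) / U_(i,i)] (lemma [betaE]).  The quotient
    is therefore the ratio of two consecutive diagonal entries of [U].  This
    ratio is positive, equals 1 when [Q = 1], and does not change under
    [T |-> E T E], which replaces [Q], [L], [U] by their conjugates by [E].

    For smoothness, [U] has to be recovered smoothly from [T].  The product of
    the first [k] diagonal entries of [U] is the leading [k]-minor of [Q].  Its
    square is the leading [k]-minor of the Gram matrix [Q^T chi_k Q] of the
    first [k] rows of [Q], where [chi_k] is the coordinate projection of rank
    [k].  But [Q^T chi_k Q] is the spectral projection of [T] for its first [k]
    eigenvalues (in the order given by the permutation), hence a polynomial in
    [T], by Lagrange interpolation.  So the quotient is given on the whole
    chart domain by one explicit function, [quotient_formula]: a square root of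
    polynomials in the entries of [T] divided by a polynomial, smooth on an
    open set of matrices that contains the chart domain
    ([spectral_minorE], [quotient_formulaE], [smooth_quotient_formula]).

    The continuous extension agrees with this formula once matrices with
    [T_(i+1,i) <> 0] are known to be dense ([chart_domain_closure]).  Given [T]
    in the chart domain, add [e] to the [i]-th subdiagonal entry of [B].  The
    unit lower triangular matrix of eigenrows of the new bidiagonal matrix is
    explicit and polynomial in [e].  Orthonormalizing its columns, which can be
    done continuously in [e] ([inv_cholesky]), gives a curve [T_e] in the chart
    domain with [T_0 = T], and [T_e] has a nonzero entry at [(i+1,i)] except for
    one value of [e] ([chart_curve]). *)

(** * Calculus of functions of class C^k *)

Section SmoothCalculus.
Variables (R : realType) (V : normedModType R).
Implicit Types (F G : V -> R) (W : set V) (k : nat).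

(** The littleo expansion that characterizes the differential only sees the
    germ of the function. *)
Lemma near_eq_differentiable F G (x : V) :
  {near x, F =1 G} -> differentiable F x -> differentiable G x.
Proof.
move=> FG dF.
have FGx : F x = G x by exact: nbhs_singleton FG.
have FG0 : \forall h \near (0 : V), F (h + x) = G (h + x).
  rewrite (near_shift x 0) /= sub0r; apply: filterS FG => y.
  by rewrite /= subrK.
have oG : G \o shift x = cst (G x) + 'd F x +o_ (0 : V) id.
  apply/eqaddoP => e e0.
  have /eqaddoP/(_ e e0) := diff_locally dF.
  by apply: filterS2 FG0 => h /=; rewrite !fctE /= FGx => ->.
have cF : continuous ('d F x) by exact: diff_continuous.
have dG := diff_unique cF oG.
by apply/diff_locallyP; rewrite dG.
Qed.

(** Derivatives at the points of an open set depend only on the values of the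
    function on that set.  The rules below need this, since the formula for the
    derivative of a product, an inverse or a square root is only valid on [W]. *)
Lemma eq_Ck_on k W F G : open W -> {in W, F =1 G} -> Ck_on k W F -> Ck_on k W G.
Proof.
move=> oW; elim: k F G => [|k IH] F G FG.
  move=> cF x Wx.
  have nFG : {near x, F =1 G}.
    by apply: filterS (open_nbhs_nbhs (conj oW Wx)) => y /mem_set; exact: FG.
  have := cF x Wx; rewrite /prop_for /continuous_at -(FG x) ?inE// => H.
  by apply: cvg_trans H; apply: near_eq_cvg; apply: filterS nFG.
have nFG x : W x -> {near x, F =1 G}.
  move=> Wx; apply: filterS (open_nbhs_nbhs (conj oW Wx)) => y /mem_set.
  exact: FG.
move=> [dF cF]; split=> [x Wx|v].
  exact: near_eq_differentiable (nFG _ Wx) (dF _ Wx).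
by apply: IH (cF v) => x; rewrite inE => Wx; apply: near_eq_derive; exact: nFG.
Qed.

(** In the inductive proofs of the rules below, the derivative of a product (or
    of an inverse, or of a square root) involves the functions themselves,
    which are then needed one order lower. *)
Lemma Ck_on_leS k W F : Ck_on k.+1 W F -> Ck_on k W F.
Proof.
elim: k F => [|k IH] F [dF cF]; first by move=> x /dF/differentiable_continuous.
by split=> // v; exact: IH.
Qed.

Lemma Ck_on_cst k W (a : R) : Ck_on k W (cst a).
Proof.
elim: k a => [|k IH] a; first by move=> x _; exact: cvg_cst.
split=> [x _|v]; first exact: differentiable_cst.
rewrite (_ : (fun _ => _) = cst 0); first exact: IH.
by apply/funext => x; rewrite derive_cst.
Qed.

Lemma Ck_on_linear k W (f : {linear V -> R^o}) :
  continuous f -> Ck_on k W (f : V -> R).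
Proof.
move=> cf; case: k => [|k]; first by move=> x _; exact: cf.
split=> [x _|v]; first exact: linear_differentiable.
rewrite (_ : (fun _ => _) = cst (f v : R)); first exact: Ck_on_cst.
apply/funext => x; rewrite deriveE; last exact: linear_differentiable.
by rewrite diff_lin.
Qed.

Lemma Ck_onD k W F G : open W -> Ck_on k W F -> Ck_on k W G -> Ck_on k W (F + G).
Proof.
move=> oW; elim: k F G => [|k IH] F G.
  by move=> cF cG x Wx; apply: cvgD; [exact: cF|exact: cG].
move=> [dF cF] [dG cG]; split=> [x Wx|v].
  by apply: differentiableD; [exact: dF|exact: dG].
apply: (eq_Ck_on oW) (IH _ _ (cF v) (cG v)) => x; rewrite inE => Wx.
by rewrite deriveD //; apply: diff_derivable; [exact: dF|exact: dG].
Qed.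

Lemma Ck_onM k W F G : open W -> Ck_on k W F -> Ck_on k W G -> Ck_on k W (F * G).
Proof.
move=> oW; elim: k F G => [|k IH] F G.
  by move=> cF cG x Wx; apply: cvgM; [exact: cF|exact: cG].
move=> CF CG; have [[dF cF] [dG cG]] := (CF, CG); split=> [x Wx|v].
  by apply: differentiableM; [exact: dF|exact: dG].
have := Ck_onD oW (IH _ _ (Ck_on_leS CF) (cG v)) (IH _ _ (Ck_on_leS CG) (cF v)).
apply: (eq_Ck_on oW) => x; rewrite inE => Wx.
by rewrite deriveM //; apply: diff_derivable; [exact: dF|exact: dG].
Qed.

Lemma Ck_onV k W F : open W -> (forall x, W x -> F x != 0) ->
  Ck_on k W F -> Ck_on k W (fun x => (F x)^-1).
Proof.
move=> oW F0; elim: k F F0 => [|k IH] F F0.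
  by move=> cF x Wx; apply: cvgV; [exact: F0|exact: cF].
move=> CF; have [dF cF] := CF; split=> [x Wx|v].
  by apply: differentiableV; [exact: dF|exact: F0].
have CV := IH _ F0 (Ck_on_leS CF).
have := Ck_onM oW (Ck_onM oW (Ck_on_cst k W (-1)) (Ck_onM oW CV CV)) (cF v).
apply: (eq_Ck_on oW) => x; rewrite inE => Wx.
rewrite deriveV ?F0//; last by apply: diff_derivable; exact: dF.
by rewrite !fctE mulN1r /GRing.scale/= expr2 invfM.
Qed.

Lemma Ck_on_sqrt k W F : open W -> (forall x, W x -> 0 < F x) ->
  Ck_on k W F -> Ck_on k W (fun x => Num.sqrt (F x)).
Proof.
move=> oW F0; elim: k F F0 => [|k IH] F F0.
  move=> cF x Wx; apply: (@continuous_comp _ _ _ F Num.sqrt); first exact: cF.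
  exact: sqrt_continuous.
move=> CF; have [dF cF] := CF.
have dS x : W x ->
    is_diff (F x) Num.sqrt ( *:%R^~ ((2 * Num.sqrt (F x))^-1) : R -> R).
  move=> Wx; have H := is_derive1_sqrt (F0 _ Wx).
  have dd : differentiable (Num.sqrt : R -> R) (F x) by apply/derivable1_diffP.
  by apply: DiffDef => //; rewrite diff1E // derive1E derive_val.
split=> [x Wx|v].
  apply: (@differentiable_comp _ _ _ _ F Num.sqrt); first exact: dF.
  by have [] := dS _ Wx.
have S0 x : W x -> Num.sqrt (F x) != 0.
  by move=> Wx; rewrite gt_eqF// sqrtr_gt0 F0.
have := Ck_onM oW (Ck_onM oW (cF v) (Ck_on_cst k W (2^-1)))
  (Ck_onV oW S0 (IH _ F0 (Ck_on_leS CF))).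
apply: (eq_Ck_on oW) => x; rewrite inE => Wx.
rewrite [RHS]deriveE; last first.
  apply: (@differentiable_comp _ _ _ _ F Num.sqrt); first exact: dF.
  by have [] := dS _ Wx.
rewrite (@diff_comp _ _ _ _ F Num.sqrt) /=; [|exact: dF|by have [] := dS _ Wx].
have [_ ->] := dS _ Wx.
rewrite -deriveE; last exact: dF.
by rewrite /GRing.scale/= invfM mulrA.
Qed.

End SmoothCalculus.

(** * Banded and triangular matrices *)

Section Band.
Variables (R : fieldType) (n : nat).
Implicit Types (A B X : 'M[R]_n) (d e : nat).

(** Entries vanish above the [d]-th superdiagonal: [band 0] means lower
    triangular and [band 1] lower Hessenberg.  Upper triangular and upper
    Hessenberg matrices are treated through their transposes. *)
Definition band d A : Prop := forall i j : 'I_n, (i + d < j)%N -> A i j = 0.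

Lemma trig_band A : is_trig_mx A <-> band 0 A.
Proof.
split=> [/is_trig_mxP tA i j|bA]; first by rewrite addn0; exact: tA.
by apply/is_trig_mxP => i j ij; apply: bA; rewrite addn0.
Qed.

Lemma band_mul d e A B : band d A -> band e B -> band (d + e) (A *m B).
Proof.
move=> bA bB i j ij; rewrite mxE big1 // => m _.
have [im|mi] := ltnP (i + d) m; first by rewrite bA // mul0r.
by rewrite bB ?mulr0 //; lia.
Qed.

(** On the extreme diagonal of a product of banded matrices only one term of
    the sum survives. *)
Lemma band_mul_edge d e A B (i m j : 'I_n) : band d A -> band e B ->
  (i + d)%N = m -> (m + e)%N = j -> (A *m B) i j = A i m * B m j.
Proof.
move=> bA bB im mj; rewrite mxE (bigD1 m) //= big1 ?addr0 // => m' m'm.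
have [lt_m|] := ltnP m m'; first by rewrite bA ?mul0r //; lia.
rewrite leq_eqVlt => /predU1P[/val_inj/eqP|lt_m]; first by rewrite (negPf m'm).
by rewrite bB ?mulr0 //; lia.
Qed.

Lemma trig_mul_diag A B (j : 'I_n) : band 0 A -> band 0 B ->
  (A *m B) j j = A j j * B j j.
Proof. by move=> bA bB; exact: (band_mul_edge bA bB (addn0 _) (addn0 _)). Qed.

(** Forward substitution: row [i] of [X] is determined by row [i] of [A *m X]
    and the previous rows of [X]. *)
Lemma band_solve d A X : band 0 A -> (forall j, A j j != 0) ->
  band d (A *m X) -> band d X.
Proof.
move=> bA A0 bAX i j; have [k] := ubnP (i : nat).
elim: k i => // k IH i ik ij; have := bAX i j ij.
rewrite mxE (bigD1 i) //= big1 ?addr0 => [/eqP|m mi].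
  by rewrite mulf_eq0 (negPf (A0 i)) => /eqP.
have [im|] := ltnP i m; first by rewrite bA ?mul0r // addn0.
rewrite leq_eqVlt => /predU1P[/val_inj/eqP|lt_m]; first by rewrite (negPf mi).
by rewrite IH ?mulr0 //; lia.
Qed.

Lemma trig_unit A : band 0 A -> (forall j, A j j != 0) -> A \in unitmx.
Proof.
move=> /trig_band tA A0; rewrite unitmxE det_trig // unitfE.
by apply/prodf_neq0 => j _.
Qed.

Lemma band_diag_mx (d : 'rV[R]_n) : band 0 (diag_mx d).
Proof. by apply/trig_band; exact: diag_mx_is_trig. Qed.

Lemma diag_commute (d : 'rV[R]_n) A : (forall i j, d 0 i = d 0 j -> i = j) ->
  diag_mx d *m A = A *m diag_mx d -> forall i j, i != j -> A i j = 0.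
Proof.
move=> dI /matrixP dA i j ij; have := dA i j.
rewrite mul_diag_mx mul_mx_diag !mxE mulrC => /eqP.
rewrite -subr_eq0 -mulrBr mulf_eq0 subr_eq0 => /orP[/eqP//|/eqP/dI/eqP].
by rewrite (negPf ij).
Qed.

End Band.

Section PositiveTriangular.
Variables (R : realFieldType) (n : nat).
Implicit Types (L U G : 'M[R]_n).

(** The matrix [X = L1^-1 L2 = U1 U2^-1] is both lower and upper triangular.
    Leaving the diagonal of [L2] free makes the lemma apply also to factors
    rescaled by signs. *)
Lemma LU_quotient L1 U1 L2 U2 :
  band 0 L1 -> (forall j, L1 j j = 1) -> band 0 L2 ->
  band 0 U1^T -> (forall j, 0 < U1 j j) ->
  band 0 U2^T -> (forall j, 0 < U2 j j) ->
  L1 *m U1 = L2 *m U2 ->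
  exists X, [/\ L2 = L1 *m X, forall i j, i != j -> X i j = 0
     & forall j, X j j = L2 j j /\ 0 < L2 j j].
Proof.
move=> bL1 L11 bL2 bU1 U1p bU2 U2p LU.
have L1u : L1 \in unitmx by apply: trig_unit => // j; rewrite L11 oner_eq0.
pose X := invmx L1 *m L2.
have L1X : L1 *m X = L2 by rewrite mulmxA mulmxV // mul1mx.
have XU : X *m U2 = U1 by rewrite -mulmxA -LU mulmxA mulVmx // mul1mx.
have bX : band 0 X.
  by apply: (band_solve bL1) => [j|]; rewrite ?L11 ?oner_eq0 ?L1X.
have bXT : band 0 X^T.
  apply: (band_solve bU2) => [j|]; first by rewrite mxE gt_eqF.
  by rewrite -trmx_mul XU.
have XL j : X j j = L2 j j by rewrite -L1X [RHS]trig_mul_diag // L11 mul1r.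
exists X; split=> // [i j|j].
  rewrite neq_ltn => /orP[ij|ji]; first by apply: bX; rewrite addn0.
  by have := bXT j i; rewrite mxE addn0; exact.
split=> //; rewrite -XL.
have := U1p j; rewrite -XU -[_ j j](mxE trmx_key (fun i j => (X *m U2) j i)).
rewrite -/(trmx _) trmx_mul trig_mul_diag // !mxE.
by rewrite pmulr_rgt0.
Qed.

(** [U1^-1 U2] is orthogonal and upper triangular with a positive diagonal. *)
Lemma inv_cholesky_unique (G U1 U2 : 'M[R]_n) :
  band 0 U1^T -> (forall j, 0 < U1 j j) -> U1^T *m G *m U1 = 1%:M ->
  band 0 U2^T -> (forall j, 0 < U2 j j) -> U2^T *m G *m U2 = 1%:M ->
  U1 = U2.
Proof.
move=> bU1 U1p UG1 bU2 U2p UG2.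
have U1n j : U1^T j j != 0 by rewrite mxE gt_eqF.
have U1Tu : U1^T \in unitmx by exact: trig_unit bU1 U1n.
have U1u : U1 \in unitmx by rewrite -unitmx_tr.
pose X := invmx U1 *m U2.
have U1X : U1 *m X = U2 by rewrite mulmxA mulmxV // mul1mx.
have XTU : X^T *m U1^T = U2^T by rewrite -trmx_mul U1X.
have XX : X^T *m X = 1%:M.
  have : X^T *m (U1^T *m G *m U1) *m X = U2^T *m G *m U2.
    by rewrite !mulmxA XTU -!mulmxA U1X.
  by rewrite UG1 UG2 mulmx1.
clearbody X.
have bV : band 0 (invmx U1^T).
  apply: (band_solve bU1 U1n); rewrite mulmxV //; apply/trig_band.
  exact: scalar_mx_is_trig.
have bXT : band 0 X^T.
  by rewrite -[X^T](mulmxK U1Tu) XTU; exact: (band_mul bU2 bV).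
have Xp j : 0 < X j j.
  have : U2^T j j = X^T j j * U1^T j j by rewrite -XTU trig_mul_diag.
  by rewrite !mxE => /esym XU; rewrite -(pmulr_lgt0 _ (U1p j)) XU.
have bX : band 0 X.
  apply: (band_solve bXT) => [j|]; first by rewrite mxE gt_eqF.
  by rewrite XX; apply/trig_band; exact: scalar_mx_is_trig.
suff X1 : X = 1%:M by rewrite -U1X X1 mulmx1.
apply/matrixP => i j; rewrite mxE; case: (ltngtP i j) => [ij|ji|/val_inj<-].
- by rewrite bX ?addn0 // -val_eqE ltn_eqF.
- by have := bXT j i; rewrite addn0 mxE -val_eqE gtn_eqF //; exact.
have := congr1 (fun M : 'M[R]_n => M i i) XX.
rewrite /= trig_mul_diag // !mxE eqxx -expr2 => /eqP.
by rewrite sqrp_eq1 ?ltW // => /eqP.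
Qed.

End PositiveTriangular.

(** * Uniqueness of the triangular factors and of the diagonalizing matrix *)

Section LU.
Variables (R : realType) (n : nat).
Implicit Types (L U Q T M : 'M[R]_n.+2).

Lemma LU_factors_unique M L1 U1 L2 U2 :
  LU_factors M L1 U1 -> LU_factors M L2 U2 -> L1 = L2.
Proof.
move=> [/trig_band bL1 L11 /trig_band bU1 U1p ->].
move=> [/trig_band bL2 L21 /trig_band bU2 U2p LU].
have [X [L2E X0 XL]] := LU_quotient bL1 L11 bL2 bU1 U1p bU2 U2p LU.
suff X1 : X = 1%:M by rewrite L2E X1 mulmx1.
apply/matrixP => i j; rewrite mxE; have [<-|/X0->//] := eqVneq.
by rewrite (XL i).1 L21.
Qed.

(** Two diagonalizing matrices differ by a matrix [D] that commutes with a
    diagonal matrix with distinct entries, so [D] is diagonal, and orthogonal,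
    so its entries are signs.  Positivity of the LU factors forces these signs
    to be positive. *)
Lemma diagonalizes_unique (lambda : 'I_n.+2 -> R) s T Q1 Q2 : injective lambda ->
  diagonalizes lambda s T Q1 -> diagonalizes lambda s T Q2 -> Q1 = Q2.
Proof.
move=> lamI; case=> O1 [L1 [U1 [/trig_band bL1 L11 /trig_band bU1 U1p Q1E]]] TE1.
case=> O2 [L2 [U2 [/trig_band bL2 L21 /trig_band bU2 U2p Q2E]]] TE2.
have TE := etrans (esym TE1) TE2.
pose D := Q1 *m Q2^T.
have O1' := mulmx1C O1; have O2' := mulmx1C O2.
have Q1D : Q1 = D *m Q2 by rewrite -mulmxA O2 mulmx1.
have D0 i j : i != j -> D i j = 0.
  apply: (@diag_commute _ _ (\row_j permuted lambda s j)).
    by move=> a b; rewrite !mxE => /lamI/perm_inj.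
  rewrite -/(Diag _) /D mulmxA.
  have : Q1 *m (Q1^T *m Diag (permuted lambda s) *m Q1) *m Q2^T =
         Q1 *m (Q2^T *m Diag (permuted lambda s) *m Q2) *m Q2^T by rewrite TE.
  by rewrite !mulmxA O1' mul1mx => ->; rewrite -!mulmxA O2' mulmx1.
have DD : D *m D^T = 1%:M.
  by rewrite /D trmx_mul trmxK mulmxA -(mulmxA Q1) O2 mulmx1 O1'.
clearbody D.
have bD : band 0 D by move=> i j; rewrite addn0 => ij; rewrite D0 // neq_ltn ij.
have bDL : band 0 (D *m L2) by exact: (band_mul bD bL2).
have LU : L1 *m U1 = (D *m L2) *m U2 by rewrite -mulmxA -Q2E -Q1E.
have [X [_ _ XL]] := LU_quotient bL1 L11 bDL bU1 U1p bU2 U2p LU.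
suff D1 : D = 1%:M by rewrite Q1D D1 mul1mx.
apply/matrixP => i j; rewrite [RHS]mxE.
have [<-|ij] := eqVneq i j; last by rewrite D0.
have [_] := XL i; rewrite trig_mul_diag // L21 mulr1 => Dp.
have := congr1 (fun M => M i i) DD; rewrite !mxE eqxx (bigD1 i) //= big1.
  rewrite addr0 mxE -expr2 => /eqP.
  by rewrite sqrp_eq1 ?ltW // => /eqP.
by move=> k ki; rewrite D0 ?mul0r // eq_sym.
Qed.

End LU.

(** * The bidiagonal coordinates in terms of the factors *)

Section Chart.
Variables (R : realType) (n : nat) (lambda : 'I_n.+2 -> R) (s : 'S_n.+2).
Hypothesis lamI : injective lambda.
Implicit Types (L U Q T M B : 'M[R]_n.+2) (i : 'I_n.+1).
Local Notation Lam := (Diag (permuted lambda s)).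

Lemma chart_QE T Q : diagonalizes lambda s T Q -> chart_Q lambda s T = Q.
Proof.
move=> dQ; apply: (diagonalizes_unique lamI) (dQ).
by apply: (@getPex _ [set Q' | diagonalizes lambda s T Q']); exists Q.
Qed.

Lemma LpartE M L U : LU_factors M L U -> Lpart M = L.
Proof.
move=> f; have [U' f'] : [set L | exists U, LU_factors M L U] (Lpart M).
  by apply: getPex; exists L, U.
exact: LU_factors_unique f' f.
Qed.

(** [T] is conjugate to [B] by [U], because [Q^-1 = Q^T]. *)
Lemma LU_intertwine Q L U T B : LU_factors Q L U -> orthogonal_mx Q ->
  T = Q^T *m Lam *m Q -> Lam *m L = L *m B -> U *m T = B *m U.
Proof.
move=> [/trig_band bL L1 _ _ QE] O -> LB.
have Lu : L \in unitmx by apply: trig_unit => // j; rewrite L1 oner_eq0.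
apply: (can_inj (mulKmx Lu)).
rewrite /= [LHS]mulmxA -QE [RHS]mulmxA -LB -[RHS]mulmxA -QE !mulmxA.
by rewrite (mulmx1C O) mul1mx.
Qed.

(** [U *m T] and [B *m U] are upper Hessenberg, so each of their subdiagonal
    entries is a single product. *)
Lemma subdiag_intertwine U T B i : band 0 U^T ->
  band 1 T^T -> band 1 B^T -> U *m T = B *m U ->
  U (lift ord0 i) (lift ord0 i) * subdiag T i =
  subdiag B i * U (widen_ord (leqnSn n.+1) i) (widen_ord (leqnSn n.+1) i).
Proof.
move=> bU bT bB /(congr1 trmx); rewrite !trmx_mul => UT.
rewrite /subdiag; set a := lift _ _; set b := widen_ord _ _.
have ab : (b + 1)%N = a by rewrite addn1 -lift0.
have := congr1 (fun M => M b a) UT.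
rewrite /= (band_mul_edge bT bU ab (addn0 _)) (band_mul_edge bU bB (addn0 _) ab).
by rewrite !mxE mulrC => ->; rewrite mulrC.
Qed.

Lemma tridiagonal_band T : T^T = T -> tridiagonal T <-> band 1 T^T.
Proof.
move=> Ts; rewrite Ts; split=> [tT j k jk|bT j k /orP[] jk].
- by apply: tT; apply/orP; left; lia.
- by apply: bT; lia.
- by rewrite -Ts mxE; apply: bT; lia.
Qed.

(** The subdiagonal entry is read off [B *m U = U *m T].  That [B] is itself
    Hessenberg follows from this relation, as [T] is tridiagonal. *)
Lemma betaE T Q L U i : isospectral lambda T -> diagonalizes lambda s T Q ->
  LU_factors Q L U ->
  beta lambda s i T =
    subdiag T i * (U (lift ord0 i) (lift ord0 i) /
                   U (widen_ord (leqnSn n.+1) i) (widen_ord (leqnSn n.+1) i)).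
Proof.
move=> [Tsym /(tridiagonal_band Tsym) bT _] dQ fL.
rewrite /beta /chart_B (chart_QE dQ) (LpartE fL).
have [ O _ TE] := dQ; have [/trig_band bL L1 /trig_band bU Up QE] := fL.
have Lu : L \in unitmx by apply: trig_unit => // j; rewrite L1 oner_eq0.
set B := invmx L *m _ *m L.
have LB : Lam *m L = L *m B by rewrite /B !mulmxA mulmxV // mul1mx.
clearbody B; have UT := LU_intertwine fL O TE LB.
have bB : band 1 B^T.
  apply: (band_solve bU) => [j|]; first by rewrite mxE gt_eqF.
  by rewrite -trmx_mul -UT trmx_mul; exact: (band_mul bT bU).
have UTi := subdiag_intertwine i bU bT bB UT.
by rewrite mulrA (mulrC (subdiag T i)) UTi mulfK // gt_eqF.
Qed.

Lemma similar_Diag Q T : Q^T *m Q = 1%:M -> T = Q^T *m Lam *m Q ->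
  similar_in unitmx T (Diag lambda).
Proof.
move=> O TE; have O' := mulmx1C O.
exists (perm_mx s^-1 *m Q).
  rewrite unitmx_mul unitmx_perm; exact: (mulmx1_unit O').1.
apply/similarP.
  rewrite unitmx_mul unitmx_perm; exact: (mulmx1_unit O').1.
rewrite TE -!mulmxA (mulmxA Q) O' mul1mx !mulmxA; congr (_ *m Q).
apply/matrixP => a b.
rewrite /Diag mul_mx_diag mul_diag_mx !mxE /permuted.
have [<-|] := eqVneq ((s^-1)%g a) b.
  by rewrite permKV mulr1 mul1r.
by rewrite mulr0 mul0r.
Qed.

End Chart.

(** * Spectral projections and leading minors *)

Section LeadingMinors.
Variables (R : realType) (n : nat).
Implicit Types (A B L U Q : 'M[R]_n) (k : nat).

Definition chi k : 'M[R]_n := diag_mx (\row_j (j < k)%:R).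

(** The leading block of size [k], completed by an identity block: keeping the
    order of the matrix fixed avoids casts, and the determinant is the leading
    minor of size [k]. *)
Definition lead k A : 'M[R]_n := chi k *m A *m chi k + (1%:M - chi k).

Definition lead_minor k A : R := \det (lead k A).

Lemma chiK k : chi k *m chi k = chi k.
Proof.
rewrite /chi mulmx_diag; congr diag_mx; apply/rowP => j; rewrite !mxE.
by case: (j < k)%N; rewrite ?mulr1 ?mulr0.
Qed.

Lemma chi_mulE k A i j : (chi k *m A) i j = (i < k)%:R * A i j.
Proof. by rewrite /chi mul_diag_mx !mxE. Qed.

Lemma mul_chiE k A i j : (A *m chi k) i j = A i j * (j < k)%:R.
Proof. by rewrite /chi mul_mx_diag !mxE. Qed.

Lemma chi_trig k L : band 0 L -> chi k *m L *m chi k = chi k *m L.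
Proof.
move=> bL; apply/matrixP => i j; rewrite mul_chiE chi_mulE.
have [jk|kj] := ltnP j k; first by rewrite mulr1.
have [ik|_] := ltnP i k; last by rewrite !mul0r.
by rewrite bL ?mulr0 ?mul0r // addn0 (leq_trans ik).
Qed.

Lemma lead_mul k A B : lead k A *m lead k B = lead k (A *m chi k *m B).
Proof.
rewrite /lead; set d := 1%:M - chi k.
have cd : chi k *m d = 0 by rewrite mulmxBr mulmx1 chiK subrr.
have dc : d *m chi k = 0 by rewrite mulmxBl mul1mx chiK subrr.
have dd : d *m d = d by rewrite {1}/d mulmxBl mul1mx cd subr0.
clearbody d.
rewrite mulmxDl !mulmxDr dd !mulmxA dc !mul0mx add0r.
rewrite -(mulmxA _ (chi k) d) cd mulmx0 addr0; congr (_ + _).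
by rewrite -(mulmxA _ (chi k) (chi k)) chiK.
Qed.

Lemma lead_tr k A : lead k A^T = (lead k A)^T.
Proof.
by rewrite /lead linearD linearB /= !trmx_mul trmx1 /chi !tr_diag_mx mulmxA.
Qed.

Lemma lead_minor_trig k L : band 0 L ->
  lead_minor k L = \prod_(j < n | (j < k)%N) L j j.
Proof.
move=> bL; have leadE i j : lead k L i j =
    (i < k)%:R * L i j * (j < k)%:R + ((i == j)%:R - (i == j)%:R * (j < k)%:R).
  rewrite /lead mxE mul_chiE chi_mulE !mxE; congr (_ + (_ - _)).
  by have [->|] := eqVneq; rewrite ?mulr1n ?mul1r ?mulr0n ?mul0r.
rewrite /lead_minor det_trig.
  rewrite [RHS]big_mkcond; apply: eq_bigr => j _; rewrite leadE eqxx.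
  by case: (j < k)%N; rewrite ?mulr1 ?mul1r ?mulr0 ?subrr ?addr0 ?add0r ?subr0.
apply/trig_band => i j ij; rewrite leadE bL // mulr0 mul0r add0r.
rewrite addn0 in ij.
by rewrite (_ : i == j = false) ?mul0r ?subr0 // -val_eqE ltn_eqF.
Qed.

(** Since [L] is lower triangular, the leading blocks of [L *m U] are the
    products of the leading blocks of [L] and [U]. *)
Lemma lead_minorM_LU k L U : band 0 L -> (forall j, L j j = 1) -> band 0 U^T ->
  lead_minor k (L *m U) = \prod_(j < n | (j < k)%N) U j j.
Proof.
move=> bL L1 bU.
have -> : lead_minor k (L *m U) = lead_minor k L * lead_minor k U.
  rewrite /lead_minor -det_mulmx lead_mul /lead; congr (\det (_ + _)).
  by rewrite !mulmxA chi_trig.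
rewrite lead_minor_trig // big1 => [|j _]; last exact: L1.
rewrite mul1r /lead_minor -det_tr -lead_tr -/(lead_minor _ _).
by rewrite lead_minor_trig //; apply: eq_bigr => j _; rewrite mxE.
Qed.

(** The leading block of the Gram matrix of the first [k] rows of [Q] is the
    Gram matrix of the leading block of [Q]. *)
Lemma lead_minor_gram k Q :
  lead_minor k (Q^T *m chi k *m Q) = lead_minor k Q ^+ 2.
Proof. by rewrite /lead_minor -lead_mul det_mulmx lead_tr det_tr expr2. Qed.

End LeadingMinors.

Section Formula.
Variables (R : realType) (n : nat).
Implicit Types (mu : 'I_n.+2 -> R) (T Q L U : 'M[R]_n.+2).

(** The Lagrange polynomial equal to 1 at the first [k] points [mu j] and to 0
    at the others. *)
Definition head_poly mu k : {poly R} :=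
  \sum_(j < n.+2 | (j < k)%N)
    \prod_(m < n.+2 | m != j) ((mu j - mu m)^-1 *: ('X - (mu m)%:P)).

Lemma head_polyE mu k j : injective mu ->
  (head_poly mu k).[mu j] = (j < k)%:R.
Proof.
move=> muI; rewrite /head_poly horner_sum.
have l0 m : m != j ->
    (\prod_(p < n.+2 | p != m) ((mu m - mu p)^-1 *: ('X - (mu p)%:P))).[mu j] = 0.
  move=> mj; rewrite horner_prod (bigD1 j) 1?eq_sym //=.
  by rewrite hornerZ hornerXsubC subrr mulr0 mul0r.
have l1 : (\prod_(p < n.+2 | p != j)
    ((mu j - mu p)^-1 *: ('X - (mu p)%:P))).[mu j] = 1.
  rewrite horner_prod big1 // => p pj.
  rewrite hornerZ hornerXsubC mulVf // subr_eq0.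
  by apply: contra pj => /eqP/muI ->.
have [jk|kj] := ltnP j k.
  rewrite (bigD1 j) //= l1 big1 ?addr0 // => m /andP[_]; exact: l0.
rewrite big1 // => m mk; apply: l0; apply: contraTneq mk => ->.
by rewrite -leqNgt.
Qed.

(** The spectral projection of [T] on the span of its first [k] eigenvectors,
    which are rows of [Q], is a polynomial in [T]. *)
Lemma head_projection mu k T Q : injective mu -> orthogonal_mx Q ->
  T = Q^T *m Diag mu *m Q -> horner_mx T (head_poly mu k) = Q^T *m chi R _ k *m Q.
Proof.
move=> muI O ->.
have Qu : Q \in unitmx := (mulmx1_unit O).2.
have -> : Q^T = invmx Q by rewrite -[LHS]mulmx1 -(mulmxV Qu) mulmxA O mul1mx.
rewrite horner_mx_uconjC // horner_mx_diag /chi; congr (_ *m diag_mx _ *m _).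
by apply/rowP => j; rewrite !mxE head_polyE.
Qed.

Definition spectral_minor mu k T : R := lead_minor k (horner_mx T (head_poly mu k)).

(** This is how the factor [U], which is constructed from [Q], is recovered
    from [T] alone. *)
Lemma spectral_minorE mu k T Q L U : injective mu -> orthogonal_mx Q ->
  T = Q^T *m Diag mu *m Q -> LU_factors Q L U ->
  spectral_minor mu k T = (\prod_(j < n.+2 | (j < k)%N) U j j) ^+ 2.
Proof.
move=> muI O TE [/trig_band bL L1 /trig_band bU _ QE].
rewrite /spectral_minor (head_projection k muI O TE) lead_minor_gram QE.
by rewrite lead_minorM_LU.
Qed.

(** With [p k] the product of the first [k] diagonal entries of [U], this is
    [p i.+2 * p i / p i.+1 ^ 2]. *)
Definition quotient_formula mu (i : 'I_n.+1) T : R :=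
  Num.sqrt (spectral_minor mu i.+2 T * spectral_minor mu i T) /
  spectral_minor mu i.+1 T.

Lemma quotient_formulaE mu (i : 'I_n.+1) T Q L U : injective mu -> orthogonal_mx Q ->
  T = Q^T *m Diag mu *m Q -> LU_factors Q L U ->
  quotient_formula mu i T =
    U (lift ord0 i) (lift ord0 i) /
    U (widen_ord (leqnSn n.+1) i) (widen_ord (leqnSn n.+1) i).
Proof.
move=> muI O TE fL; rewrite /quotient_formula !(spectral_minorE _ muI O TE fL).
have [_ _ _ Up _] := fL.
(* the products telescope: P k.+1 = U_kk * P k *)
pose P k := \prod_(j < n.+2 | (j < k)%N) U j j; rewrite -!/(P _).
have Pp k : 0 < P k by apply: prodr_gt0.
have PS (a : 'I_n.+2) : P a.+1 = U a a * P a.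
  rewrite /P (bigD1 a) //=; congr (_ * _); apply: eq_bigl => j.
  by rewrite ltnS [RHS]ltn_neqAle andbC val_eqE.
set a := lift _ _; set b := widen_ord _ _.
have -> : P i.+2 = U a a * P i.+1 by rewrite -PS /a lift0.
have -> : P i.+1 = U b b * P i by rewrite -PS.
rewrite -exprMn sqrtr_sqr ger0_norm; last first.
  by rewrite !mulr_ge0 ?ltW.
have := Pp i; have := Up b; set p := P i; set u := U b b => u0 p0.
by field; rewrite !gt_eqF.
Qed.

End Formula.

(** * Families of matrices of class C^k *)

Section MatrixCk.
Variables (R : realType) (V : normedModType R) (k : nat) (W : set V).
Hypothesis oW : open W.

Lemma Ck_on_sum (I : Type) (r : seq I) (P : pred I) (F : I -> V -> R) :
  (forall i, Ck_on k W (F i)) -> Ck_on k W (fun x => \sum_(i <- r | P i) F i x).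
Proof.
move=> CF; elim: r => [|i r IH].
  by under eq_fun do rewrite big_nil; exact: Ck_on_cst.
under eq_fun do rewrite big_cons.
by case: (P i) => //; exact: (Ck_onD oW (CF i) IH).
Qed.

Lemma Ck_on_prod (I : Type) (r : seq I) (P : pred I) (F : I -> V -> R) :
  (forall i, Ck_on k W (F i)) -> Ck_on k W (fun x => \prod_(i <- r | P i) F i x).
Proof.
move=> CF; elim: r => [|i r IH].
  by under eq_fun do rewrite big_nil; exact: Ck_on_cst.
under eq_fun do rewrite big_cons.
by case: (P i) => //; exact: (Ck_onM oW (CF i) IH).
Qed.

Definition Ck_mx m n (M : V -> 'M[R]_(m, n)) : Prop :=
  forall i j, Ck_on k W (fun x => M x i j).

Lemma Ck_mx_cst m n (A : 'M[R]_(m, n)) : Ck_mx (fun=> A).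
Proof. by move=> i j; exact: Ck_on_cst. Qed.

Lemma Ck_mxD m n (M N : V -> 'M[R]_(m, n)) :
  Ck_mx M -> Ck_mx N -> Ck_mx (fun x => M x + N x).
Proof.
move=> CM CN i j; under eq_fun do rewrite mxE.
exact: (Ck_onD oW (CM i j) (CN i j)).
Qed.

Lemma Ck_mxZ m n (f : V -> R) (M : V -> 'M[R]_(m, n)) :
  Ck_on k W f -> Ck_mx M -> Ck_mx (fun x => f x *: M x).
Proof.
move=> Cf CM i j; under eq_fun do rewrite mxE.
exact: (Ck_onM oW Cf (CM i j)).
Qed.

Lemma Ck_mxM m n p (M : V -> 'M[R]_(m, n)) (N : V -> 'M[R]_(n, p)) :
  Ck_mx M -> Ck_mx N -> Ck_mx (fun x => M x *m N x).
Proof.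
move=> CM CN i j; under eq_fun do rewrite mxE.
by apply: Ck_on_sum => l; exact: (Ck_onM oW (CM i l) (CN l j)).
Qed.

Lemma Ck_mx_tr m n (M : V -> 'M[R]_(m, n)) : Ck_mx M -> Ck_mx (fun x => (M x)^T).
Proof. by move=> CM i j; under eq_fun do rewrite mxE; exact: CM. Qed.

Lemma Ck_on_det n (M : V -> 'M[R]_n) : Ck_mx M -> Ck_on k W (fun x => \det (M x)).
Proof.
move=> CM; apply: Ck_on_sum => s.
apply: (Ck_onM oW (Ck_on_cst k W _)).
by apply: Ck_on_prod => i; exact: CM.
Qed.

Lemma Ck_mx_horner n (p : {poly R}) (M : V -> 'M[R]_n.+1) :
  Ck_mx M -> Ck_mx (fun x => horner_mx (M x) p).
Proof.
move=> CM; elim/poly_ind: p => [|p c IH].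
  by under eq_fun do rewrite rmorph0; exact: Ck_mx_cst.
under eq_fun do rewrite rmorphD rmorphM /= horner_mx_X horner_mx_C.
by apply: Ck_mxD; [exact: Ck_mxM|exact: Ck_mx_cst].
Qed.

Lemma Ck_mx_block m1 m2 n1 n2 (A : V -> 'M[R]_(m1, n1)) (B : V -> 'M[R]_(m1, n2))
    (C : V -> 'M[R]_(m2, n1)) (D : V -> 'M[R]_(m2, n2)) :
  Ck_mx A -> Ck_mx B -> Ck_mx C -> Ck_mx D ->
  Ck_mx (fun x => block_mx (A x) (B x) (C x) (D x)).
Proof.
move=> CA CB CC CD i j; rewrite -[i]fintype.splitK -[j]fintype.splitK.
case: (fintype.split i) => i'; case: (fintype.split j) => j' /=.
- by under eq_fun do rewrite block_mxEul; exact: CA.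
- by under eq_fun do rewrite block_mxEur; exact: CB.
- by under eq_fun do rewrite block_mxEdl; exact: CC.
- by under eq_fun do rewrite block_mxEdr; exact: CD.
Qed.

Definition posdef n (G : 'M[R]_n) : Prop :=
  G^T = G /\ forall v : 'cV_n, v != 0 -> 0 < (v^T *m G *m v) 0 0.

(** Bordering: for a matrix with first entry [a], first column [(a, b)] and
    remaining block [C], the Schur complement [S = C - b b^T / a] is again
    positive definite.  If [U'^T S U' = 1], then the block matrix with rows
    [(1 / sqrt a, - b^T U' / a)] and [(0, U')] does the same for the whole matrix.
    These formulas preserve the class C^k in the parameter. *)
Lemma inv_cholesky n (G : V -> 'M[R]_n) : Ck_mx G ->
  (forall x, W x -> posdef (G x)) ->
  exists U : V -> 'M[R]_n, Ck_mx U /\ forall x, W x ->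
    [/\ band 0 (U x)^T, forall j, 0 < U x j j & (U x)^T *m G x *m U x = 1%:M].
Proof.
elim: n G => [|n IH] G CG pG.
  exists (fun=> 1%:M); split=> [|x Wx]; first exact: Ck_mx_cst.
  by split=> [[]//|[]//|]; rewrite [LHS]flatmx0 [RHS]flatmx0.
rewrite -[n.+1]/(1 + n)%N in G CG pG *.
pose a x := G x (lshift n 0) (lshift n 0).
pose b x := dlsubmx (G x).
pose S x := drsubmx (G x) - (a x)^-1 *: (b x *m (b x)^T).
have GE x : W x -> G x = block_mx (a x)%:M (b x)^T (b x) (drsubmx (G x)).
  move=> Wx; rewrite -[LHS]submxK; congr block_mx.
    by apply/matrixP => i j; rewrite !ord1 !mxE eqxx mulr1n.
  by rewrite /b trmx_dlsub (pG x Wx).1.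
have a0 x : W x -> 0 < a x.
  move=> Wx; have := (pG x Wx).2 (delta_mx (lshift n 0) 0).
  rewrite trmx_delta -rowE -colE !mxE; apply.
  apply/eqP => /matrixP/(_ (lshift n 0) 0); rewrite !mxE !eqxx => /eqP.
  by rewrite oner_eq0.
have Ca : Ck_on k W a by exact: CG.
have CaV : Ck_on k W (fun x => (a x)^-1).
  by apply: Ck_onV => // x /a0 ?; rewrite gt_eqF.
have Cb : Ck_mx b.
  by move=> i j; under eq_fun do rewrite !mxE; exact: CG.
have CS : Ck_mx S.
  rewrite /S; under eq_fun do rewrite -scaleN1r scalerA mulN1r.
  apply: Ck_mxD; first by move=> i j; under eq_fun do rewrite !mxE; exact: CG.
  apply: Ck_mxZ; last by apply: Ck_mxM => //; exact: Ck_mx_tr.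
  under eq_fun do rewrite -mulN1r.
  exact: (Ck_onM oW (Ck_on_cst k W (-1)) CaV).
have pS x : W x -> posdef (S x).
  move=> Wx; have [GT Gp] := pG x Wx; split.
    rewrite /S linearB linearZ /= trmx_mul trmxK; congr (_ - _).
    by rewrite trmx_drsub GT.
  move=> v v0; pose t := - (a x)^-1 *: ((b x)^T *m v).
  have := Gp (col_mx t v); rewrite {1}(GE x Wx).
  rewrite -mulmxA mul_block_col tr_col_mx mul_row_col mul_scalar_mx.
  have -> : a x *: t + (b x)^T *m v = 0.
    by rewrite /t scalerA mulrN mulfV ?gt_eqF ?a0 // scaleN1r addNr.
  have -> : b x *m t + drsubmx (G x) *m v = S x *m v.
    by rewrite /t /S mulmxBl addrC -scalemxAr -scalemxAl scaleNr mulmxA.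
  rewrite mulmx0 add0r mulmxA; apply; apply: contra v0 => /eqP.
  by rewrite -[0]col_mx0 => /eq_col_mx[_ ->].
have [U' [CU' U'P]] := IH S CS pS.
pose w x := - (a x)^-1 *: ((b x)^T *m U' x).
pose r x := (Num.sqrt (a x))^-1.
exists (fun x => block_mx (r x)%:M (w x) 0 (U' x)); split.
  apply: Ck_mx_block => //; last exact: Ck_mx_cst.
    move=> i j; rewrite !ord1; under eq_fun do rewrite !mxE eqxx mulr1n.
    apply: Ck_onV => //; last exact: Ck_on_sqrt.
    by move=> x Wx; rewrite gt_eqF // sqrtr_gt0 a0.
  apply: Ck_mxZ; last by apply: Ck_mxM => //; exact: Ck_mx_tr.
  under eq_fun do rewrite -mulN1r.
  exact: (Ck_onM oW (Ck_on_cst k W (-1)) CaV).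
move=> x Wx; have [bU' U'p U'S] := U'P x Wx; split.
- move=> i j; rewrite addn0 mxE -[i]fintype.splitK -[j]fintype.splitK.
  case: (fintype.split i) => i'; case: (fintype.split j) => j' /= ij;
    rewrite ?ord1 //.
  + by rewrite !ord1 in ij.
  + by rewrite block_mxEdl mxE.
  + by rewrite !ord1 in ij.
  + by rewrite block_mxEdr; have := bU' i' j'; rewrite mxE; apply; lia.
- move=> j; rewrite -[j]fintype.splitK; case: (fintype.split j) => j' /=.
    by rewrite block_mxEul !ord1 mxE eqxx mulr1n invr_gt0 sqrtr_gt0 a0.
  by rewrite block_mxEdr.
- rewrite {1}(GE x Wx) -mulmxA mulmx_block tr_block_mx mulmx_block.
  rewrite !mulmx0 !addr0 !trmx0 !mul0mx !addr0 tr_scalar_mx.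
  have -> : (a x)%:M *m w x + (b x)^T *m U' x = 0.
    by rewrite mul_scalar_mx /w scalerA mulrN mulfV ?gt_eqF ?a0 // scaleN1r addNr.
  have -> : b x *m w x + drsubmx (G x) *m U' x = S x *m U' x.
    by rewrite /w /S mulmxBl addrC -scalemxAr -scalemxAl scaleNr mulmxA.
  have -> : (U' x)^T *m (S x *m U' x) = 1%:M by rewrite mulmxA.
  rewrite !mulmx0 add0r.
  have -> : (w x)^T *m ((a x)%:M *m (r x)%:M) + (U' x)^T *m (b x *m (r x)%:M) = 0.
    rewrite !mulmxA -mulmxDl [(w x)^T *m _]mul_mx_scalar /w linearZ /=.
    by rewrite trmx_mul trmxK scalerA mulrN mulfV ?gt_eqF ?a0 // scaleN1r
      addNr mul0mx.
  have rar : r x * (a x * r x) = 1.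
    rewrite /r -{2}(sqr_sqrtr (ltW (a0 x Wx))).
    by field; rewrite gt_eqF // sqrtr_gt0 a0.
  by rewrite -!scalar_mxM rar -scalar_mx_block.
Qed.

End MatrixCk.

Lemma mx_continuous (R : realType) (T : topologicalType) m n
    (M : T -> 'M[R]_(m, n)) (x : T) :
  (forall i j, {for x, continuous (fun y => M y i j)}) -> {for x, continuous M}.
Proof.
move=> cM; apply/cvg_ballP => e e0.
have : \forall y \near x, forall i j, ball (M x i j) e (M y i j).
  apply: filter_forall => i; apply: filter_forall => j.
  by have /cvg_ballP/(_ e e0) := cM i j.
by apply: filterS => y By; split.
Qed.

Section Smoothness.
Variables (R : realType) (n : nat).
Implicit Types (mu : 'I_n.+2 -> R) (W : set 'M[R]_n.+2) (T : 'M[R]_n.+2).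

Lemma Ck_on_spectral_minor l W mu k : open W -> Ck_on l W (spectral_minor mu k).
Proof.
move=> oW; apply: (Ck_on_det oW); rewrite /lead.
apply: (Ck_mxD oW); last exact: Ck_mx_cst.
apply: (Ck_mxM oW); last exact: Ck_mx_cst.
apply: (Ck_mxM oW); first exact: Ck_mx_cst.
apply: (Ck_mx_horner oW) => i j.
have lin : linear (fun M : 'M[R]_n.+2 => M i j : R^o).
  by move=> c A B; rewrite !mxE.
pose f : {linear 'M[R]_n.+2 -> R^o} :=
  HB.pack (fun M : 'M[R]_n.+2 => M i j : R^o)
    (GRing.isLinear.Build _ _ _ _ _ lin).
by apply: (@Ck_on_linear _ _ l W f); exact: coord_continuous.
Qed.

Definition formula_domain mu (i : 'I_n.+1) : set 'M[R]_n.+2 :=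
  [set T | 0 < spectral_minor mu i.+2 T * spectral_minor mu i T] `&`
  [set T | spectral_minor mu i.+1 T != 0].

Lemma spectral_minor_continuous mu k : continuous (spectral_minor mu k).
Proof. by move=> T; exact: (@Ck_on_spectral_minor 0 setT mu k openT T). Qed.

Lemma open_formula_domain mu i : open (formula_domain mu i).
Proof.
apply: openI.
  apply: (@open_comp _ _ (fun T => spectral_minor mu i.+2 T * spectral_minor mu i T)
    [set y | 0 < y]); last exact: open_gt.
  by move=> T _; apply: continuousM; exact: spectral_minor_continuous.
apply: (@open_comp _ _ (spectral_minor mu i.+1) [set y | y != 0]);
  last exact: open_neq.
by move=> T _; exact: spectral_minor_continuous.
Qed.

Lemma smooth_quotient_formula mu i :
  smooth_on_open (formula_domain mu i) (quotient_formula mu i).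
Proof.
have oW := @open_formula_domain mu i; move=> k.
have Cm l : Ck_on k (formula_domain mu i) (spectral_minor mu l).
  exact: Ck_on_spectral_minor.
apply: (Ck_onM oW).
  by apply: (Ck_on_sqrt oW) (Ck_onM oW (Cm _) (Cm _)) => T [].
by apply: (Ck_onV oW) (Cm _) => T [].
Qed.

End Smoothness.

(** * Bidiagonal matrices and their eigenrows *)

Section Bidiagonal.
Variables (R : realType) (n : nat).
Implicit Types (mu : 'I_n.+1 -> R) (b : nat -> R) (L B : 'M[R]_n.+1).

Definition bidiag mu b : 'M[R]_n.+1 :=
  \matrix_(m, j) if m == j then mu j else if (m == j.+1 :> nat) then b j else 0.

(** Row [k] is the left eigenvector of [bidiag mu b] for the eigenvalue [mu k]
    with [k]-th entry 1: the entries to the left solve the recursion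
    [x_j * mu j + x_(j+1) * b j = mu k * x_j]. *)
Definition eigenrows mu b : 'M[R]_n.+1 :=
  \matrix_(k, j) if (j <= k)%N
                 then \prod_(j <= m < k) (b m / (mu k - mu (inord m))) else 0.

Lemma band_eigenrows mu b : band 0 (eigenrows mu b).
Proof. by move=> k j; rewrite addn0 => kj; rewrite mxE leqNgt kj. Qed.

Lemma eigenrows_diag mu b j : eigenrows mu b j j = 1.
Proof. by rewrite mxE leqnn big_geq. Qed.

Lemma eigenrowsE mu b : injective mu ->
  diag_mx (\row_j mu j) *m eigenrows mu b = eigenrows mu b *m bidiag mu b.
Proof.
move=> muI; apply/matrixP => k j.
rewrite mul_diag_mx mxE [X in X * _]mxE [RHS]mxE.
rewrite (bigD1 j) //= [bidiag _ _ j j]mxE eqxx.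
have [jk|] := ltnP j k; last first.
  rewrite leq_eqVlt => kj; rewrite big1 ?addr0 => [|m mj].
    case/predU1P: kj => [/val_inj->|kj]; first by rewrite !eigenrows_diag mulrC.
    by rewrite (@band_eigenrows mu b k j) ?addn0 // mulr0 mul0r.
  rewrite [bidiag _ _ _ _]mxE (negPf mj).
  case: eqVneq => [mE|_]; last by rewrite mulr0.
  rewrite (@band_eigenrows mu b k m) ?mul0r // addn0 mE.
  by case/predU1P: kj => [->|/ltnW]; rewrite ?ltnS.
have j1 : (j.+1 < n.+1)%N by rewrite (leq_ltn_trans jk).
rewrite (bigD1 (Ordinal j1)) /=; last by rewrite -val_eqE /= gtn_eqF.
rewrite big1 ?addr0 => [|m /andP[mj mj1]]; last first.
  rewrite [bidiag _ _ _ _]mxE (negPf mj).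
  case: eqVneq => [mE|_]; last by rewrite mulr0.
  by case/eqP: mj1; apply/val_inj.
rewrite !mxE /= eqxx -val_eqE /= gtn_eqF // (ltnW jk) jk.
rewrite [X in _ * X = _](big_ltn jk) [X in X * mu j](big_ltn jk) inord_val.
have kj0 : mu k - mu j != 0.
  by rewrite subr_eq0; apply: contraTneq jk => /muI->; rewrite ltnn.
by field.
Qed.

(** [L' L^-1] commutes with a diagonal matrix with distinct entries. *)
Lemma eigenrows_unique mu L L' B : injective mu ->
  band 0 L -> (forall j, L j j = 1) -> band 0 L' -> (forall j, L' j j = 1) ->
  diag_mx (\row_j mu j) *m L = L *m B -> diag_mx (\row_j mu j) *m L' = L' *m B ->
  L = L'.
Proof.
move=> muI bL L1 bL' L1' LB LB'.
have Lu : L \in unitmx by apply: trig_unit => // j; rewrite L1 oner_eq0.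
pose D := L' *m invmx L.
have DL : D *m L = L' by rewrite -mulmxA mulVmx // mulmx1.
have D0 i j : i != j -> D i j = 0.
  apply: (@diag_commute _ _ (\row_j mu j)).
    by move=> a b; rewrite !mxE => /muI.
  by rewrite mulmxA LB' -(mulmxK Lu (_ *m diag_mx _)) -(mulmxA D) LB mulmxA DL.
clearbody D.
have bD : band 0 D by move=> i j; rewrite addn0 => ij; rewrite D0 // neq_ltn ij.
suff D1 : D = 1%:M by rewrite -DL D1 mul1mx.
apply/matrixP => i j; rewrite mxE; have [<-|ij] := eqVneq i j; last by rewrite D0.
have := congr1 (fun M : 'M[R]_n.+1 => M i i) DL.
by rewrite /= trig_mul_diag // L1 mulr1 L1'.
Qed.

End Bidiagonal.

(** * Density of the matrices with a nonzero subdiagonal entry *)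

Section Density.
Variables (R : realType) (n : nat) (lambda : 'I_n.+2 -> R) (s : 'S_n.+2).
Hypothesis lamI : injective lambda.
Implicit Types (L U Q T E : 'M[R]_n.+2) (i : 'I_n.+1).
Local Notation mu := (permuted lambda s).

Lemma permuted_inj : injective mu.
Proof. by move=> a b /lamI/perm_inj. Qed.

Lemma chart_domain_intro T Q : orthogonal_mx Q -> LU_positive Q ->
  T = Q^T *m Diag mu *m Q -> tridiagonal T -> chart_domain lambda s T.
Proof.
move=> O LUQ TE tT; split; last by exists Q.
split=> //; last exact: similar_Diag O TE.
by rewrite TE !trmx_mul trmxK tr_diag_mx mulmxA.
Qed.

(** Conjugating by a sign diagonal preserves triangularity and diagonal
    entries, so it maps LU-positive factorizations to LU-positive ones. *)
Lemma sign_conjugation T Q L U E : sign_diagonal E -> orthogonal_mx Q ->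
  LU_factors Q L U -> T = Q^T *m Diag mu *m Q ->
  [/\ orthogonal_mx (E *m Q *m E),
      LU_factors (E *m Q *m E) (E *m L *m E) (E *m U *m E),
      E *m T *m E = (E *m Q *m E)^T *m Diag mu *m (E *m Q *m E)
    & forall j, (E *m U *m E) j j = U j j].
Proof.
move=> [e [e1 EE]] O [/trig_band bL L1 /trig_band bU Up QE] TE.
have ee j : e j * e j = 1 by case: (e1 j) => ->; rewrite ?mulrNN mulr1.
have EK : E *m E = 1%:M.
  apply/matrixP => a b; rewrite EE /Diag mul_diag_mx !mxE.
  by have [->|_] := eqVneq a b; rewrite ?mulr1n ?ee // mulr0n mulr0.
have ET : E^T = E by rewrite EE /Diag tr_diag_mx.
have bE : band 0 E by rewrite EE; exact: band_diag_mx.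
have EMEE (M : 'M[R]_n.+2) a b : (E *m M *m E) a b = e a * M a b * e b.
  by rewrite EE /Diag mul_mx_diag mul_diag_mx !mxE.
have EMEd (M : 'M[R]_n.+2) a : (E *m M *m E) a a = M a a.
  by rewrite EMEE mulrAC ee mul1r.
have EDE : E *m Diag mu *m E = Diag mu.
  apply/matrixP => a b; rewrite EMEE !mxE.
  by have [->|_] := eqVneq; rewrite ?mulr0n ?mulr0 ?mul0r // mulrAC ee mul1r.
split=> //.
- rewrite /orthogonal_mx !trmx_mul ET !mulmxA -(mulmxA (E *m _) E E) EK mulmx1.
  by rewrite -(mulmxA E) O mulmx1 EK.
- split.
  + by apply/trig_band; exact: (band_mul (band_mul bE bL) bE).
  + by move=> j; rewrite EMEd.
  + apply/trig_band; rewrite !trmx_mul ET.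
    exact: (band_mul bE (band_mul bU bE)).
  + by move=> j; rewrite EMEd.
  + by rewrite !mulmxA -(mulmxA (E *m L) E E) EK mulmx1 QE mulmxA.
- rewrite !trmx_mul ET -{1}EDE TE !mulmxA.
  by rewrite -(mulmxA _ E E) EK mulmx1 -(mulmxA _ E E) EK mulmx1.
Qed.

Lemma band_bidiag b : band 1 (bidiag mu b)^T.
Proof.
move=> j m jm; rewrite !mxE; case: eqVneq => [mj|_]; last by case: eqP => //; lia.
by rewrite mj in jm; lia.
Qed.

Lemma subdiag_bidiag b i : subdiag (bidiag mu b) i = b i.
Proof. by rewrite /subdiag mxE -val_eqE lift0 gtn_eqF //= eqxx. Qed.

(** Perturb the [i]-th subdiagonal entry of the bidiagonal matrix of [T].  The
    eigenrows [Le e] of the result are polynomial in [e], and [Ue e] makes their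
    columns orthonormal.  Then [Te e] is conjugate to the bidiagonal matrix by
    [Ue e], hence Hessenberg, and it is symmetric, hence tridiagonal. *)
Lemma chart_curve T i : chart_domain lambda s T ->
  exists Te : R -> 'M[R]_n.+2, exists c : R,
  [/\ Te 0 = T, {for 0, continuous Te}, forall e, chart_domain lambda s (Te e)
    & forall e, e != c -> subdiag (Te e) i != 0].
Proof.
move=> [[Ts /(tridiagonal_band Ts) bT _] [Q dQ]].
have [ O [L [U fL]] TE] := dQ.
have [/trig_band bL L1 /trig_band bU Up QE] := fL.
have Lu : L \in unitmx by apply: trig_unit => // j; rewrite L1 oner_eq0.
pose B := invmx L *m Diag mu *m L.
have LB : Diag mu *m L = L *m B by rewrite /B !mulmxA mulmxV // mul1mx.
have UT := LU_intertwine fL O TE LB.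
have bB : band 1 B^T.
  apply: (band_solve bU) => [j|]; first by rewrite mxE gt_eqF.
  by rewrite -trmx_mul -UT trmx_mul; exact: (band_mul bT bU).
have bB0 : band 0 B.
  apply: (band_solve bL) => [j|]; first by rewrite L1 oner_eq0.
  by rewrite -LB; exact: (band_mul (band_diag_mx _) bL).
have Bd j : B j j = mu j.
  have := congr1 (fun M : 'M[R]_n.+2 => M j j) LB.
  rewrite /= (trig_mul_diag _ (band_diag_mx _) bL) (trig_mul_diag _ bL bB0) L1 mul1r.
  by rewrite mulr1 !mxE eqxx mulr1n.
pose b m := B (inord m.+1) (inord m).
have BE : B = bidiag mu b.
  apply/matrixP => m j; rewrite [RHS]mxE.
  have [<-//|mj] := eqVneq m j.
  have [mjE|mj1] := eqVneq (m : nat) j.+1; first by rewrite /b -mjE !inord_val.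
  case: (ltngtP m j) => [lt_mj|lt_jm|/val_inj mjE]; first by rewrite bB0 ?addn0.
    by have := bB j m; rewrite mxE; apply; lia.
  by rewrite mjE eqxx in mj.
pose be (e : R) m := b m + e * (m == i)%:R.
pose Le e := eigenrows mu (be e).
(* at e = 0 the eigenrows are those of B itself, which form L *)
have LE : L = Le 0.
  apply: (eigenrows_unique permuted_inj bL L1 (@band_eigenrows _ _ _ _)
    (eigenrows_diag _ _) LB).
  rewrite eigenrowsE; last exact: permuted_inj.
  by rewrite BE; congr (_ *m bidiag _ _); apply/funext => m; rewrite /be mul0r addr0.
have CL : Ck_mx 0 setT (Le : R^o -> 'M[R]_n.+2).
  move=> k j; have [jk|kj] := leqP j k; last first.
    rewrite (_ : (fun e => Le e k j) = cst 0); first exact: Ck_on_cst.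
    by apply/funext => e; rewrite band_eigenrows ?addn0.
  rewrite (_ : (fun e => Le e k j) =
    (fun e => \prod_(j <= m < k) (be e m / (mu k - mu (inord m))))); last first.
    by apply/funext => e; rewrite mxE jk.
  apply: (@Ck_on_prod _ R^o _ _ openT) => m.
  apply: (@Ck_onM _ R^o _ _ _ _ openT); last exact: Ck_on_cst.
  apply: (@Ck_onD _ R^o _ _ _ _ openT); first exact: Ck_on_cst.
  apply: (@Ck_onM _ R^o _ _ _ _ openT); last exact: Ck_on_cst.
  by move=> x _; exact: cvg_id.
have CG := Ck_mxM openT (Ck_mx_tr CL) CL.
have pG e : setT e -> posdef ((Le e)^T *m Le e).
  move=> _; split; first by rewrite trmx_mul trmxK.
  move=> v v0; rewrite mulmxA -mulmxA -trmx_mul.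
  have Leu : Le e \in unitmx.
    apply: (trig_unit (@band_eigenrows _ _ _ _)) => j.
    by rewrite eigenrows_diag oner_eq0.
  have : Le e *m v != 0.
    by apply: contra v0 => /eqP Lv; rewrite -(mulKmx Leu v) Lv mulmx0.
  set w := Le e *m v => w0; rewrite mxE.
  under eq_bigr do rewrite mxE -expr2.
  rewrite lt_neqAle sumr_ge0 ?andbT => [|j _]; last exact: sqr_ge0.
  apply: contra w0; rewrite eq_sym psumr_eq0 => [/allP w0|j _]; last exact: sqr_ge0.
  apply/eqP/colP => j; rewrite [RHS]mxE; apply/eqP.
  by have := w0 j (mem_index_enum _); rewrite /= sqrf_eq0.
have [Ue [CU UeP]] := inv_cholesky openT CG pG.
pose Qe e := Le e *m Ue e.
pose Te e := (Qe e)^T *m Diag mu *m Qe e.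
have Oe e : orthogonal_mx (Qe e).
  have [_ _ UG] := UeP e I.
  by rewrite /orthogonal_mx -UG /Qe trmx_mul !mulmxA.
have fe e : LU_factors (Qe e) (Le e) (Ue e).
  have [bUe Uep _] := UeP e I.
  split=> //; [|exact: eigenrows_diag|]; apply/trig_band => //.
  exact: band_eigenrows.
have UTe e : Ue e *m Te e = bidiag mu (be e) *m Ue e.
  by apply: (LU_intertwine (fe e) (Oe e) (erefl _)); exact: eigenrowsE permuted_inj.
have bTe e : band 1 (Te e)^T.
  have [bUe Uep _] := UeP e I.
  have Uen j : (Ue e)^T j j != 0 by rewrite mxE gt_eqF.
  have bV : band 0 (invmx (Ue e)^T).
    apply: (band_solve bUe Uen); rewrite mulmxV; last exact: trig_unit bUe Uen.
    by apply/trig_band; exact: scalar_mx_is_trig.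
  rewrite -[(Te e)^T](mulmxK (trig_unit bUe Uen)) -trmx_mul UTe trmx_mul.
  exact: (band_mul (band_mul bUe (@band_bidiag _)) bV).
have Tes e : (Te e)^T = Te e.
  by rewrite /Te trmx_mul [X in _ *m X]trmx_mul trmxK tr_diag_mx mulmxA.
(* the i-th bidiagonal coordinate of Te e is b i + e *)
exists Te; exists (- b i); split.
- rewrite TE /Te /Qe; have -> : Ue 0 = U.
    have [bUe Uep UG] := UeP 0 I; apply: inv_cholesky_unique bUe Uep UG bU Up _.
    by rewrite -LE mulmxA -mulmxA -trmx_mul -QE; exact: O.
  by rewrite -LE -QE.
- apply: mx_continuous => j k.
  have CQ := Ck_mxM openT CL CU.
  exact: (Ck_mxM openT (Ck_mxM openT (Ck_mx_tr CQ) (Ck_mx_cst _ _ _)) CQ j k 0 I).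
- move=> e; apply: (@chart_domain_intro _ (Qe e)) => //.
    by exists (Le e), (Ue e).
  exact/(tridiagonal_band (Tes e)).
- move=> e; apply: contra => /eqP Te0.
  have [bUe Uep _] := UeP e I.
  have := subdiag_intertwine i bUe (bTe e) (@band_bidiag _) (UTe e).
  rewrite Te0 mulr0 subdiag_bidiag => /esym/eqP.
  by rewrite mulf_eq0 (gt_eqF (Uep _)) orbF /be eqxx mulr1 addrC addr_eq0.
Qed.

Lemma chart_domain_closure i :
  chart_domain lambda s `<=` closure (unreduced_at lambda s i).
Proof.
move=> T UT; have [Te [c [Te0 cTe UTe Tene]]] := chart_curve i UT.
have [c0|c0] := eqVneq c 0; last first.
  by apply: subset_closure; split=> //; rewrite -Te0; apply: Tene; rewrite eq_sym.
move=> N; rewrite -Te0 => /cTe NT.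
have NT0 : \forall e \near (0 : R)^', N (Te e) /\ e != 0.
  change (\forall e \near (0 : R), e != 0 -> N (Te e) /\ e != 0).
  have NT' : \forall e \near (0 : R), N (Te e) by exact: NT.
  by apply: filterS NT' => e Ne e0; split.
have [e [Ne e0]] := @filter_ex _ _ (Proper_dnbhs_numFieldType (0 : R)) _ NT0.
exists (Te e); split=> //; split=> //.
by apply: Tene; rewrite c0.
Qed.

End Density.

(** * The quotient *)

Theorem proposition3p8 (R : realType) (n : nat) (lambda : 'I_n.+2 -> R)
    (lambda_incr : forall j k : 'I_n.+2, (j < k)%N -> lambda j < lambda k)
    (s : 'S_n.+2) (i : 'I_n.+1) :
  let U := chart_domain lambda s in
  let q := ext_quotient lambda s i in
  [/\ (* the quotient extends continuously, in a unique way, to U *)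
      U `<=` closure (unreduced_at lambda s i) /\
      (forall T, U T ->
        raw_quotient lambda s i S
          @[S --> within (unreduced_at lambda s i) (nbhs T)] --> q T),
      smooth_on U q,
      (forall T, U T -> 0 < q T),
      U (Diag (permuted lambda s)) /\ q (Diag (permuted lambda s)) = 1
    & forall T E : 'M[R]_n.+2, U T -> sign_diagonal E ->
        U (E *m T *m E) /\ q (E *m T *m E) = q T].
Proof.
move=> U q.
have lamI : injective lambda.
  move=> a b ab; apply/val_inj; case: (ltngtP a b) => // /lambda_incr.
    by rewrite ab ltxx.
  by rewrite ab ltxx.
have muI := @permuted_inj _ _ _ s lamI.
set mu := permuted lambda s in muI *.
pose F := quotient_formula mu i.
have closU : U `<=` closure (unreduced_at lambda s i) by exact: chart_domain_closure.
have UW : U `<=` formula_domain mu i.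
  move=> T [_ [Q [ O [L [V fL]] TE]]]; rewrite /formula_domain /=.
  rewrite !(spectral_minorE _ muI O TE fL) -exprMn.
  have [_ _ _ Vp _] := fL.
  have Pp k : 0 < \prod_(j < n.+2 | (j < k)%N) V j j by apply: prodr_gt0.
  by split; rewrite /= ?gt_eqF ?exprn_gt0 ?mulr_gt0.
have rawE T : U T -> subdiag T i != 0 -> raw_quotient lambda s i T = F T.
  move=> [isoT [Q dQ]] T0; have [ O [L [V fL]] TE] := dQ.
  rewrite /raw_quotient (betaE lamI i isoT dQ fL) /F.
  by rewrite (quotient_formulaE i muI O TE fL) mulrC mulKf.
have cF T : U T -> raw_quotient lambda s i S
    @[S --> within (unreduced_at lambda s i) (nbhs T)] --> F T.
  move=> UT.
  have FT : F S @[S --> within (unreduced_at lambda s i) (nbhs T)] --> F T.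
    apply: cvg_within_filter.
    exact: (@smooth_quotient_formula _ _ mu i 0 T (UW _ UT)).
  apply: cvg_trans FT; apply: near_eq_cvg.
  by apply: filterS (withinT _ _) => S [US S0]; rewrite rawE.
have qE T : U T -> q T = F T.
  move=> UT; rewrite /q /ext_quotient; case: ifPn => [T0|_]; first exact: rawE.
  have PF : ProperFilter (within (unreduced_at lambda s i) (nbhs T)).
    by apply: within_nbhs_proper; exact: closU.
  by apply: cvg_lim => //; exact: cF.
have formE T Q L V : orthogonal_mx Q -> T = Q^T *m Diag mu *m Q ->
    LU_factors Q L V -> F T = V (lift ord0 i) (lift ord0 i) /
    V (widen_ord (leqnSn n.+1) i) (widen_ord (leqnSn n.+1) i).
  by move=> O TE fL; exact: quotient_formulaE muI O TE fL.
have tri1 : tridiagonal (Diag mu).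
  move=> j k jk; rewrite !mxE; case: eqVneq => // jkE.
  by move: jk; rewrite jkE; lia.
have O1 : orthogonal_mx (1%:M : 'M[R]_n.+2) by rewrite /orthogonal_mx trmx1 mulmx1.
have f1 : LU_factors (1%:M : 'M[R]_n.+2) 1%:M 1%:M.
  by split; rewrite ?trmx1 ?mulmx1 ?scalar_mx_is_trig // => j; rewrite mxE eqxx.
have E1 : Diag mu = 1%:M^T *m Diag mu *m 1%:M by rewrite trmx1 mul1mx mulmx1.
have U1 : U (Diag mu).
  by apply: (chart_domain_intro O1 _ E1 tri1); exists 1%:M, 1%:M.
split.
- by split=> // T UT; rewrite qE //; exact: cF.
- move=> T UT; exists (formula_domain mu i); exists F; split.
  + exact: open_formula_domain.
  + exact: UW.
  + exact: smooth_quotient_formula.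
  + by move=> S US _; rewrite qE.
- move=> T UT; rewrite qE //; have [_ [Q [ O [L [V fL]] TE]]] := UT.
  by rewrite (formE _ _ _ _ O TE fL) divr_gt0 //; have [] := fL.
- by split=> //; rewrite qE // (formE _ _ _ _ O1 E1 f1) !mxE !eqxx divr1.
- move=> T E UT signE; have [[_ tT _] [Q [ O [L [V fL]] TE]]] := UT.
  have [OE fE TEE VE] := sign_conjugation signE O fL TE.
  have tE : tridiagonal (E *m T *m E).
    have [e [_ ->]] := signE.
    move=> j k jk; rewrite /Diag mul_mx_diag mul_diag_mx !mxE.
    by rewrite tT // mulr0 mul0r.
  have UE : U (E *m T *m E).
    apply: (chart_domain_intro OE _ TEE tE).
    by exists (E *m L *m E), (E *m V *m E).
  split=> //; rewrite !qE //.
  by rewrite (formE _ _ _ _ OE TEE fE) (formE _ _ _ _ O TE fL) !VE.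
Qed.
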